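(* Consider the following task for a register machine: it reads a positive integer $m$, then $m$ positive integers $q_1,\ldots,q_m$, then an integer $k\in\{1,\ldots,m\}$ (in this order), and must output $q_k$. Let $r=\log(\max\{2,q_1,\ldots,q_m\})$ and $f(m,r)=r\cdot m\cdot\log(m)$. Then (i) no register machine solves this task in $o(f(m,r))$ steps when the Little Oh is taken in sense (a); and (ii) there is a register machine solving this task in $o(f(m,r))$ steps when the Little Oh is taken in sense (b).
   Context: Model (addition machine): a program is a finite list of numbered lines; the machine has finitely many registers, each holding an arbitrary integer. Allowed commands, each counting as one step: $x=y+z$, $x=y+k$, $x=y-z$, $x=y-k$, $x=k-y$, $x=k$ (registers $x,y,z$, integer constants $k$); ''read $x$''/''write $x$'' of a whole integer; ''if $x\,R\,y$'' and ''if $x\,R\,k$'' conditionals with $R\in\{<,=,>,\neq,\leq,\geq\}$; ''goto $\ell$''. Finitely many finite-range variables may also be used. The running time on an input is the number of executed commands; a machine solves the task in $o(f(m,r))$ steps if its (worst-case) running time $g(m,r)$ over inputs with parameters $m,r$ satisfies $g\in o(f)$. Multivariate Little Oh: (a) $g(m,r)\in o(f(m,r))$ iff for every rational $c>0$ there is $c'>0$ such that for all $(m,r)$ with $\max\{m,r\}\geq c'$ one has $g(m,r)\leq c\cdot f(m,r)$; (b) $g(m,r)\in o(f(m,r))$ iff for every rational $c>0$ there is $c'$ such that for all $(m,r)$ with $\min\{m,r\}\geq c'$ one has $g(m,r)\leq c\cdot f(m,r)$. *)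

(* Defs.v *)
From HB Require Import structures.
From mathcomp Require Import all_boot all_order all_algebra.
From mathcomp Require Import all_classical all_reals all_analysis.

Set Implicit Arguments.
Unset Strict Implicit.
Unset Printing Implicit Defensive.

Import Order.TTheory GRing.Theory Num.Theory.

Local Open Scope ring_scope.
Local Open Scope classical_set_scope.

Variant relop := OpLt | OpEq | OpGt | OpNe | OpLe | OpGe.

Definition compare_with (c : relop) (a b : int) : bool :=
  match c with
  | OpLt => a < b
  | OpEq => a == b
  | OpGt => b < a
  | OpNe => a != b
  | OpLe => a <= b
  | OpGe => b <= a
  end.

(* [n] registers; [F] is the set of joint values of the finite-range
   variables, so that [SetFin] updates and [IfFin] tests any of them.
   Conditionals carry the lines at which execution continues when the
   condition is true and when it is false. *)
Variant command (n : nat) (F : finType) :=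
  | AddReg (x y z : 'I_n)             (* x = y + z *)
  | AddCst (x y : 'I_n) (k : int)     (* x = y + k *)
  | SubReg (x y z : 'I_n)             (* x = y - z *)
  | SubCst (x y : 'I_n) (k : int)     (* x = y - k *)
  | CstSub (x : 'I_n) (k : int) (y : 'I_n)  (* x = k - y *)
  | SetCst (x : 'I_n) (k : int)       (* x = k *)
  | Read (x : 'I_n)
  | Write (x : 'I_n)
  | IfReg (x : 'I_n) (c : relop) (y : 'I_n) (lt lf : nat)
  | IfCst (x : 'I_n) (c : relop) (k : int) (lt lf : nat)
  | Goto (l : nat)
  | SetFin (u : F -> F)
  | IfFin (p : pred F) (lt lf : nat).

Record machine := Machine {
  nregs : nat;
  finvars : finType;
  fin_init : finvars;
  program : seq (command nregs finvars)
}.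

Record config (n : nat) (F : finType) := Config {
  line : nat;
  regs : {ffun 'I_n -> int};
  fin : F;
  input : seq int;
  output : seq int
}.

Definition update (n : nat) (s : {ffun 'I_n -> int}) (x : 'I_n) (v : int)
  : {ffun 'I_n -> int} := [ffun i => if i == x then v else s i].

Section Execution.
Variable M : machine.
Let n := nregs M.
Let F := finvars M.

Definition exec (cmd : command n F) (C : config n F) : option (config n F) :=
  let: Config l s a inp out := C in
  let assign x v := Some (Config l.+1 (update s x v) a inp out) in
  let jump l' := Some (Config l' s a inp out) in
  match cmd with
  | AddReg x y z => assign x (s y + s z)
  | AddCst x y k => assign x (s y + k)
  | SubReg x y z => assign x (s y - s z)
  | SubCst x y k => assign x (s y - k)
  | CstSub x k y => assign x (k - s y)
  | SetCst x k => assign x k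
  | Read x =>
      if inp is v :: inp' then Some (Config l.+1 (update s x v) a inp' out)
      else None
  | Write x => Some (Config l.+1 s a inp (rcons out (s x)))
  | IfReg x c y lt lf => jump (if compare_with c (s x) (s y) then lt else lf)
  | IfCst x c k lt lf => jump (if compare_with c (s x) k then lt else lf)
  | Goto l' => jump l'
  | SetFin u => Some (Config l.+1 s (u a) inp out)
  | IfFin p lt lf => jump (if p a then lt else lf)
  end.

(* [None] when there is no command at the current line, or when reading from
   an exhausted input. *)
Definition step (C : config n F) : option (config n F) :=
  obind (fun cmd => exec cmd C) (onth (program M) (line C)).

Fixpoint run (t : nat) (C : config n F) : option (config n F) :=
  if t is t'.+1 then obind (run t') (step C) else Some C.

Definition initial (inp : seq int) : config n F :=
  Config 0 [ffun => 0] (fin_init M) inp [::].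

(* The machine halts when control leaves the program; in particular, reading
   from an exhausted input is not halting. *)
Definition halts_with (inp : seq int) (t : nat) (out : seq int) : Prop :=
  exists C, [/\ run t (initial inp) = Some C,
                (size (program M) <= line C)%N & output C = out].

End Execution.

Section Task.

(* The type of [qidx] forces [0 < len]; the index k in {1, ..., m} of the task
   is [qidx.+1]. *)
Record instance := Instance {
  len : nat;
  qs : len.-tuple nat;
  qs_gt0 : forall i : 'I_len, (0 < tnth qs i)%N;
  qidx : 'I_len
}.

Definition task_input (I : instance) : seq int :=
  (len I)%:Z :: rcons [seq q%:Z | q <- qs I] (qidx I).+1%:Z.

Definition task_output (I : instance) : seq int := [:: (tnth (qs I) (qidx I))%:Z].

Definition solves (M : machine) : Prop :=
  forall I : instance, exists t, halts_with M (task_input I) t (task_output I).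

Variable R : realType.

Definition log2 (x : R) : R := ln x / ln 2.

Definition param_r (I : instance) : R :=
  log2 (maxn 2 (\max_(i < len I) tnth (qs I) i))%:R.

(* Equals -oo at the pairs (m, r) that are not the parameters of any instance,
   so that such pairs impose nothing in the Little Oh conditions below. *)
Definition worst_time (M : machine) (m : nat) (r : R) : \bar R :=
  ereal_sup [set (t%:R)%:E | t in
    [set t : nat | exists I out, [/\ len I = m, param_r I = r &
                                     halts_with M (task_input I) t out]]].

Definition bound (m : nat) (r : R) : R := r * m%:R * log2 m%:R.

Definition littleo_max (g : nat -> R -> \bar R) (f : nat -> R -> R) : Prop :=
  forall c : rat, 0 < c -> exists2 c' : R, 0 < c' &
    forall (m : nat) (r : R), c' <= Num.max m%:R r ->
      (g m r <= (ratr c * f m r)%:E)%E.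

Definition littleo_min (g : nat -> R -> \bar R) (f : nat -> R -> R) : Prop :=
  forall c : rat, 0 < c -> exists c' : R,
    forall (m : nat) (r : R), c' <= Num.min m%:R r ->
      (g m r <= (ratr c * f m r)%:E)%E.

End Task.

(* Main.v *)
(* (i) At m = 1 the bound is r * 1 * log 1 = 0, while writing the answer takes
   at least one step.
   (ii) A machine running in O(r * m) steps stores q_1, ..., q_m as a continued
   fraction: starting from (A, B) = (2, 1), reading q replaces (A, B) by
   (q * A + B, A).  As 0 < B < A, the last q is the quotient of A by B, so the
   values are recovered in the order q_m, q_(m-1), ..., down to q_k.
   Multiplication and division by q share one routine, which maintains the
   Fibonacci multiples (a, b) = (F_n x, F_(n+1) x) and (c, d) = (F_n y, F_(n+1) y)
   of two numbers: it climbs until b > u and then comes back, which only needs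
   subtractions, taking a off u and adding c to v whenever a <= u.  It turns
   (u, v) into (u mod x, v + (u div x) y) in O(log (u / x)) steps. *)

Require Import Defs.
From mathcomp Require Import all_boot all_order all_algebra.
From mathcomp Require Import all_classical all_reals all_analysis.
From mathcomp Require Import zify.

Set Implicit Arguments.
Unset Strict Implicit.
Unset Printing Implicit Defensive.

Import Order.TTheory GRing.Theory Num.Theory.

Local Open Scope ring_scope.

(** * Determinism of runs *)

Section Runs.
Variable M : machine.
Implicit Types C : config (nregs M) (finvars M).

Lemma run_add s t C C' :
  run s C = Some C' -> run (s + t) C = run t C'.
Proof.
elim: s C => [|s IHs] C /=; first by case=> ->.
by case: (step C) => //= C1 /IHs.
Qed.

Lemma run_halted t C :
  (size (program M) <= line C)%N -> run t.+1 C = None.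
Proof.
move=> Ch; rewrite /= /step; suff -> : onth (program M) (line C) = None by [].
exact: onth_default.
Qed.

(** A halted configuration has no successor. Thus a bound on one halting run bounds the supremum in
    [worst_time]. *)
Lemma halts_with_inj inp t t' out out' :
  halts_with M inp t out -> halts_with M inp t' out' -> t = t'.
Proof.
wlog ltt' : t t' out out' / (t < t')%N => [hw|] H H'.
  by case: (ltngtP t t') => // lt; [exact: hw lt H H' | exact/esym/(hw _ _ _ _ lt H' H)].
case: H => C [Ct Ch _]; case: H' => C' [C't' _ _]; move: C't'.
by rewrite -(subnKC (ltnW ltt')) (run_add _ Ct) -[(t' - t)%N]prednK ?subn_gt0 // run_halted.
Qed.

End Runs.

(** * The selector machine and its symbolic execution *)

Section Selector.

Let ra := @Ordinal 8 0 isT.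
Let rb := @Ordinal 8 1 isT.
Let rc := @Ordinal 8 2 isT.
Let rd := @Ordinal 8 3 isT.
Let ru := @Ordinal 8 4 isT.
Let rv := @Ordinal 8 5 isT.
Let rm := @Ordinal 8 6 isT.
Let rj := @Ordinal 8 7 isT.

(* Lines 8-22 are the routine.  Lines 5-27 read and push the q's, with B and A
   in [rv] and [rd]; lines 28-41 pop them, with A and B in [ru] and [rb].  The
   finite variable tells which of the two phases has called the routine. *)
Definition selector_program : seq (command 8 bool) := [::
  (*  0 *) Read _ rm;
  (*  1 *) AddCst _ rj rm 0;
  (*  2 *) SetCst _ rb 1;
  (*  3 *) SetCst _ rv 1;
  (*  4 *) SetCst _ rd 2;
  (*  5 *) IfCst _ rj OpEq 0 28 6;
  (*  6 *) SubCst _ rj rj 1;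
  (*  7 *) Read _ ru;
  (*  8 *) IfReg _ rb OpLe ru 9 14;
  (*  9 *) AddReg _ rb ra rb;
  (* 10 *) SubReg _ ra rb ra;
  (* 11 *) AddReg _ rd rc rd;
  (* 12 *) SubReg _ rc rd rc;
  (* 13 *) Goto _ _ 8;
  (* 14 *) IfCst _ ra OpEq 0 23 15;
  (* 15 *) IfReg _ ra OpLe ru 16 18;
  (* 16 *) SubReg _ ru ru ra;
  (* 17 *) AddReg _ rv rv rc;
  (* 18 *) SubReg _ ra rb ra;
  (* 19 *) SubReg _ rb rb ra;
  (* 20 *) SubReg _ rc rd rc;
  (* 21 *) SubReg _ rd rd rc;
  (* 22 *) Goto _ _ 14;
  (* 23 *) IfFin _ id 35 24;
  (* 24 *) AddReg _ rv rv rd;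
  (* 25 *) SubReg _ rd rv rd;
  (* 26 *) SubReg _ rv rv rd;
  (* 27 *) Goto _ _ 5;
  (* 28 *) AddCst _ ru rd 0;
  (* 29 *) AddCst _ rb rv 0;
  (* 30 *) SetCst _ rd 1;
  (* 31 *) Read _ rj;
  (* 32 *) SetFin _ (fun=> true);
  (* 33 *) SetCst _ rv 0;
  (* 34 *) Goto _ _ 8;
  (* 35 *) IfReg _ rm OpEq rj 41 36;
  (* 36 *) SubCst _ rm rm 1;
  (* 37 *) AddReg _ ru ru rb;
  (* 38 *) SubReg _ rb ru rb;
  (* 39 *) SubReg _ ru ru rb;
  (* 40 *) Goto _ _ 33;
  (* 41 *) Write _ rv ].

Definition selector : machine := @Machine 8 bool false selector_program.

Definition regfile (a b c d u v m j : int) : {ffun 'I_8 -> int} :=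
  [ffun i : 'I_8 => nth 0 [:: a; b; c; d; u; v; m; j] i].

Lemma update_regfile a b c d u v m j (i : 'I_8) x :
  update (regfile a b c d u v m j) i x =
  let s := set_nth 0 [:: a; b; c; d; u; v; m; j] i x in
  regfile s`_0 s`_1 s`_2 s`_3 s`_4 s`_5 s`_6 s`_7.
Proof.
apply/ffunP => k; rewrite !ffunE.
by case: i => [[|[|[|[|[|[|[|[|?]]]]]]]] //= ?]; case: k => [[|[|[|[|[|[|[|[|?]]]]]]]] //= ?].
Qed.

Definition conf l a b c d u v m j (p : bool) inp out : config 8 bool :=
  Config l (regfile a b c d u v m j) p inp out.

Definition srun : nat -> config 8 bool -> option (config 8 bool) :=
  @run selector.
Arguments srun : simpl never.

Lemma srunS t C : srun t.+1 C = obind (srun t) (@step selector C).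
Proof. by []. Qed.

Lemma srun0 C : srun 0 C = Some C. Proof. by []. Qed.

Lemma srun_trans s t C C' C'' :
  srun s C = Some C' -> srun t C' = Some C'' -> srun (s + t) C = Some C''.
Proof. by move=> H H'; exact: etrans (@run_add selector s t C C' H) H'. Qed.

Ltac exec :=
  rewrite /conf;
  repeat lazymatch goal with
  | |- context [srun _ (Config (if _ then _ else _) _ _ _ _)] => fail
  | _ => rewrite srunS /step /= ?update_regfile /= ?ffunE /=
  end; rewrite ?srun0.

Lemma start_run inp m :
  srun 5 (@initial selector (m :: inp)) =
  Some (conf 5 0 1 0 2 0 1 m m false inp [::]).
Proof.
have regfile0 : [ffun=> 0] = regfile 0 0 0 0 0 0 0 0.
  by apply/ffunP => -[[|[|[|[|[|[|[|[|?]]]]]]]] // ?]; rewrite !ffunE.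
by rewrite /initial regfile0; exec; rewrite addr0.
Qed.

Lemma push_read_run A B (n : nat) q m inp :
  srun 3 (conf 5 0 1 0 A 0 B m n.+1%:Z false (q :: inp) [::]) =
  Some (conf 8 0 1 0 A q B m n%:Z false inp [::]).
Proof. by exec; rewrite intS addrC addKr. Qed.

(** * The Fibonacci routine *)

Lemma up_run (a b c d u v m j : int) p inp out : b <= u ->
  srun 6 (conf 8 a b c d u v m j p inp out) =
  Some (conf 8 b (a + b) d (c + d) u v m j p inp out).
Proof. by move=> bu; exec; rewrite bu; exec; rewrite ![a + b]addrC ![c + d]addrC !addrK. Qed.

Lemma top_run (a b c d u v m j : int) p inp out : u < b ->
  srun 1 (conf 8 a b c d u v m j p inp out) =
  Some (conf 14 a b c d u v m j p inp out).
Proof. by move=> ub; exec; rewrite leNgt ub. Qed.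

Lemma down_run (a b c d u v m j : int) p inp out : 0 < b ->
  exists2 t, (t <= 9)%N &
  srun t (conf 14 b (a + b) d (c + d) u v m j p inp out) =
  Some (conf 14 a b c d (if b <= u then u - b else u)
                        (if b <= u then v + d else v) m j p inp out).
Proof.
move=> b0; case: ifP => bu; [exists 9 | exists 7] => //.
all: exec; rewrite gt_eqF //; exec; rewrite bu; exec.
all: by rewrite !addrK ![a + b]addrC ![c + d]addrC !addrK.
Qed.

(* Two climbs at least double [b], which bounds the depth by 2 L.  The last
   clause expresses v' - v = (u - u') / x * y for the x, y of which (a, b) and
   (c, d) are the Fibonacci multiples, without mentioning Fibonacci numbers. *)
Lemma routine_run L (a b c d u v m j : int) p inp out :
  0 <= a <= b -> 0 < b -> 0 <= u -> u < (2 ^ L)%:Z * b ->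
  exists t u' v',
  [/\ (t <= 30 * L + 1)%N,
      srun t (conf 8 a b c d u v m j p inp out) =
        Some (conf 14 a b c d u' v' m j p inp out),
      0 <= u' < b &
      forall x y, c * x = a * y -> d * x = b * y ->
        (v' - v) * x = (u - u') * y].
Proof.
elim: L a b c d => [|L IHL] a b c d /andP[a0 ab] b0 u0 uL.
  exists 1, u, v; rewrite top_run; last by move: uL; rewrite mul1r.
  by split; [|by []|rewrite u0; move: uL; rewrite mul1r|move=> *; rewrite !subrr !mul0r].
case: (ltP u b) => [ub|bu].
  exists 1, u, v; rewrite top_run //.
  by split; [lia|by []|rewrite u0|move=> *; rewrite !subrr !mul0r].
(* The second climb of this level. A climb and its descent take at most 6 + 9 steps, hence 16 = 1 +
   15 here and 30 per level. *)
have [t1 [u1 [v1 [t1L r1 u1b prop1]]]] : exists t u' v',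
    [/\ (t <= 30 * L + 16)%N,
      srun t (conf 8 b (a + b) d (c + d) u v m j p inp out) =
        Some (conf 14 b (a + b) d (c + d) u' v' m j p inp out),
      0 <= u' < a + b &
      forall x y, c * x = a * y -> d * x = b * y ->
        (v' - v) * x = (u - u') * y].
  case: (ltP u (a + b)) => [uab|abu].
    exists 1, u, v; rewrite top_run //.
    by split; [lia|by []|rewrite u0|move=> *; rewrite !subrr !mul0r].
  have [||||t1 [u1 [v1 [t1L r1 u1b prop1]]]] := IHL (a + b) (b + (a + b)) (c + d) (d + (c + d)).
  - lia.
  - lia.
  - lia.
  - by apply: (lt_le_trans uL); rewrite expnS; nia.
  have [|t2 t29 r2] := @down_run b (a + b) d (c + d) u1 v1 m j p inp out; first lia.
  exists (6 + t1 + t2)%N, (if a + b <= u1 then u1 - (a + b) else u1),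
    (if a + b <= u1 then v1 + (c + d) else v1); split.
  - lia.
  - exact: srun_trans (srun_trans (up_run _ _ _ _ _ _ _ _ _ abu) r1) r2.
  - by case: ifP => h; lia.
  - move=> x y e1 e2.
    have := prop1 x y; case: ifP => h; nia.
have [|t2 t29 r2] := @down_run a b c d u1 v1 m j p inp out; first lia.
exists (6 + t1 + t2)%N, (if b <= u1 then u1 - b else u1),
  (if b <= u1 then v1 + d else v1); split.
- lia.
- exact: srun_trans (srun_trans (up_run _ _ _ _ _ _ _ _ _ bu) r1) r2.
- by case: ifP => h; lia.
- move=> x y e1 e2.
  have := prop1 x y e1 e2; case: ifP => h; nia.
Qed.

(** * Pushing and popping the continued fraction *)

Lemma push_exit_run d u v m j inp :
  srun 6 (conf 14 0 1 0 d u v m j false inp [::]) =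
  Some (conf 5 0 1 0 v u d m j false inp [::]).
(* One sum and two differences swap [d] and [v] without a scratch register. *)
Proof. by exec; rewrite addrK [v + d]addrC addrK. Qed.

Lemma pop_start_run A B m k :
  srun 8 (conf 5 0 1 0 A 0 B m 0 false [:: k] [::]) =
  Some (conf 8 0 B 0 1 A 0 m k true [::] [::]).
Proof. by exec; rewrite !addr0. Qed.

Lemma pop_exit_run b u v m k : m != k ->
  srun 10 (conf 14 0 b 0 1 u v m k true [::] [::]) =
  Some (conf 8 0 u 0 1 b 0 (m - 1) k true [::] [::]).
Proof. by move=> mk; exec; rewrite (negPf mk); exec; rewrite addrK [u + b]addrC addrK. Qed.

Lemma pop_write_run b u v k :
  srun 4 (conf 14 0 b 0 1 u v k k true [::] [::]) =
  Some (conf 42 0 b 0 1 u v k k true [::] [:: v]).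
Proof. by exec; rewrite eqxx; exec. Qed.

(** The fraction A / B becomes q + 1 / (A / B). *)
Definition push (AB : nat * nat) (q : nat) : nat * nat :=
  (q * AB.1 + AB.2, AB.1)%N.

Lemma foldl_push_bounds AB s : all (leq 1) s -> (0 < AB.2 < AB.1)%N ->
  (0 < (foldl push AB s).2 < (foldl push AB s).1)%N.
Proof.
elim: s AB => //= q s IHs [A B] /andP[q0 s0] AB; apply: IHs => //=.
move: AB => /=; nia.
Qed.

Lemma pushes_run L m inp (s : seq nat) AB :
  all (fun q => 0 < q < 2 ^ L)%N s ->
  exists2 t, (t <= size s * (30 * L + 10))%N &
  srun t (conf 5 0 1 0 AB.1%:Z 0 AB.2%:Z m (size s)%:Z false
            ([seq q%:Z | q <- s] ++ inp) [::]) =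
  Some (conf 5 0 1 0 (foldl push AB s).1%:Z 0 (foldl push AB s).2%:Z m 0 false
            inp [::]).
Proof.
elim: s AB => [|q s IHs] AB /=; first by exists 0.
move=> /andP[/andP[q0 qL] /(IHs (push AB q)) [t2 t2L r2]].
(* Multiplication: dividing q by x = 1 leaves 0 and adds q times y = A to B. *)
have [||||t1 [u [v [t1L r1 u01 prop]]]] :=
    @routine_run L 0 1 0 AB.1%:Z q%:Z AB.2%:Z m (size s)%:Z false
      ([seq q%:Z | q <- s] ++ inp) [::]; [lia..|].
have uE : u = 0 by lia.
have vE : v = (q * AB.1 + AB.2)%N%:Z.
  have := prop 1 AB.1%:Z; rewrite uE; nia.
exists (3 + t1 + 6 + t2)%N; first by nia.
apply: (srun_trans _ r2); rewrite -vE; rewrite uE in r1.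
apply: (srun_trans _ (push_exit_run _ _ _ _ _ _)).
exact: srun_trans (push_read_run _ _ _ _ _ _) r1.
Qed.

(** The cost of a pop depends on the size of the quotient q only, not on the size of the stored
    pair, which grows with [s]. *)
Lemma pops_run L (s : seq nat) (k : nat) AB :
  (0 < AB.2 < AB.1)%N -> all (fun q => 0 < q < 2 ^ L)%N s ->
  (k < size s)%N ->
  exists t C, [/\ (t <= size s * (30 * L + 11))%N,
    srun t (conf 8 0 (foldl push AB s).2%:Z 0 1 (foldl push AB s).1%:Z 0
              (size s)%:Z k.+1%:Z true [::] [::]) = Some C,
    line C = 42 & output C = [:: (nth 0%N s k)%:Z]].
Proof.
move=> AB0; elim/last_ind: s => [|s q IHs] //.
rewrite all_rcons size_rcons foldl_rcons nth_rcons => /andP[/andP[q0 qL] sL] ks.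
have s0 : all (leq 1) s by apply: sub_all sL => x /andP[].
have := foldl_push_bounds s0 AB0.
move: IHs; case: (foldl push AB s) => A B /= IHs BA.
(* Division with x = A and y = 1; from B < A and q + 1 <= [2 ^ L] follows q A + B < [2 ^ L] A. *)
have [||||t1 [u [v [t1L r1 u01 prop]]]] :=
    @routine_run L 0 A%:Z 0 1 (q * A + B)%N%:Z 0 (size s).+1%:Z k.+1%:Z true
      [::] [::]; [lia|lia|lia|nia|].
have vuE : v * A%:Z = (q * A + B)%N%:Z - u.
  by have := prop A%:Z 1; rewrite !mul0r !mul1r !mulr1 subr0 => ->.
have vE : v = q%:Z by nia.
have uE : u = B%:Z by nia.
rewrite vE uE in r1.
case: (eqVneq k (size s)) ks => [kE _|ks ksS].
  rewrite kE ltnn; rewrite kE in r1; exists (t1 + 4)%N.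
  exists (conf 42 0 A%:Z 0 1 B%:Z q%:Z (size s).+1%:Z (size s).+1%:Z true [::] [:: q%:Z]).
  split=> //; [nia | exact: srun_trans r1 (pop_write_run _ _ _ _)].
have {}ks : (k < size s)%N by lia.
have [t2 [C [t2L r2 lC oC]]] := IHs sL ks.
rewrite ks; exists (t1 + 10 + t2)%N, C; split => //; first nia.
apply: (srun_trans _ r2); apply: (srun_trans r1 _).
rewrite pop_exit_run; last lia.
by rewrite intS [1 + _]addrC addrK.
Qed.

Lemma selector_halts L (I : instance) :
  (forall i, tnth (qs I) i < 2 ^ L)%N -> (0 < L)%N ->
  exists2 t, (t <= 120 * (len I * L))%N &
    halts_with selector (task_input I) t (task_output I).
Proof.
case: I => m q q0 k /= qL L0.
have qin : all (fun x => 0 < x < 2 ^ L)%N q.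
  by apply/allP => x /tnthP[i ->]; rewrite q0 qL.
have m0 : (0 < m)%N by apply: leq_ltn_trans (ltn_ord k).
have [t1 t1L r1] := @pushes_run L m%:Z [:: k.+1%:Z] q (2, 1)%N qin.
have [||t2 [C [t2L r2 lC oC]]] := @pops_run L q k (2, 1)%N _ qin.
- by [].
- by rewrite size_tuple.
rewrite size_tuple in t1L r1 t2L r2.
(* At most 60 m L + 21 m + 13 steps, with m and L at least 1. *)
exists (5 + t1 + 8 + t2)%N; first nia.
exists C; split; last 2 first.
- by rewrite lC.
- by rewrite oC /task_output /= (tnth_nth 0%N).
apply: (srun_trans _ r2); apply: (srun_trans _ (pop_start_run _ _ _ _)).
by apply: (srun_trans (start_run _ _)); rewrite -cats1.
Qed.

End Selector.

(** * Logarithmic estimates and the two Little Oh statements *)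

Section Bounds.
Variable R : realType.

Lemma ler_log2 (n k : nat) : (2 ^ k <= n)%N -> k%:R <= log2 (n%:R : R).
Proof.
move=> kn; have ln2 : 0 < ln 2 :> R by rewrite ln_gt0 // ltr1n.
rewrite /log2 ler_pdivlMr // mulr_natl -lnXn ?ltr0n // -natrX.
by rewrite ler_ln ?posrE ?ltr0n ?expn_gt0 ?(leq_trans _ kn) ?ler_nat // expn_gt0.
Qed.

Lemma selector_time (I : instance) :
  exists2 t, t%:R <= 240 * (param_r R I * (len I)%:R) :> R &
    halts_with selector (task_input I) t (task_output I).
Proof.
set Q := maxn 2 (\max_(i < len I) tnth (qs I) i).
have Q2 : (2 <= Q)%N by exact: leq_maxl.
have l1 : (1 <= trunc_log 2 Q)%N by rewrite -(trunc_expnK (p := 2) 1) // leq_trunc_log.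
have [||t tL ht] := @selector_halts (trunc_log 2 Q).+1 I; last exists t => //.
- move=> i; apply: leq_ltn_trans (trunc_log_ltn Q _) => //.
  by rewrite leq_max; apply/orP; right; apply: (leq_bigmax i).
- by [].
have lr : (trunc_log 2 Q)%:R <= param_r R I by apply/ler_log2/trunc_logP => //; lia.
(* By [l1] the successor at most doubles [trunc_log 2 Q], so 120 becomes 240. *)
have {tL} : (t <= 240 * (trunc_log 2 Q * len I))%N by nia.
rewrite -(ler_nat R) => /le_trans; apply.
by rewrite natrM ler_pM2l // natrM ler_wpM2r.
Qed.

Lemma selector_solves : solves selector.
Proof. by move=> I; have [t _ ht] := selector_time I; exists t. Qed.

Lemma selector_littleo : littleo_min (@worst_time R selector) (@bound R).
Proof.
move=> c c0; have rc0 : 0 < ratr c :> R by rewrite ltr0q.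
have ln2 : 0 < ln 2 :> R by rewrite ln_gt0 // ltr1n.
(* This is 2 to the power 240 / c, so that log m >= 240 / c. *)
exists (expR (ln 2 * (240 / ratr c))) => m r.
rewrite le_min => /andP[cm _]; apply: ge_ereal_sup => _ [t /= [I [out [Im Ir ht]]] <-].
have [t' t'r ht'] := selector_time I.
rewrite (halts_with_inj ht ht') lee_fin (le_trans t'r) // Im Ir /bound.
have m0 : 0 < m%:R :> R by apply: lt_le_trans cm; rewrite expR_gt0.
have lm : 240 <= ratr c * log2 (m%:R : R).
  rewrite mulrC -ler_pdivrMr // /log2 ler_pdivlMr // mulrC.
  by rewrite -(expRK (ln 2 * _)) ler_ln ?posrE ?expR_gt0.
have r0 : 0 <= r.
  by rewrite -Ir; apply: le_trans (ler_log2 (k := 0) _); rewrite // leq_max.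
have := ler_wpM2r (mulr_ge0 r0 (ltW m0)) lm.
by rewrite -[_ * log2 _ * _]mulrA [log2 _ * (_ * _)]mulrC.
Qed.

(* At [m = 1] the bound vanishes, but no machine answers in zero steps. *)
Lemma no_littleo_max M :
  solves M -> ~ littleo_max (@worst_time R M) (@bound R).
Proof.
move=> solM /(_ 1 ltr01)[c' _ c'P].
have [K cK] : exists K : nat, c' <= K.+1%:R.
  by exists (Num.truncn c'); apply/ltW/truncnS_gt.
(* A single entry so large that r alone reaches [c']. *)
have q0 (i : 'I_1) : (0 < tnth [tuple (2 ^ K.+1)%N] i)%N.
  by rewrite (tnth_nth 0%N) /= ord1 /= expn_gt0.
pose I := Instance q0 ord0.
have cr : c' <= Num.max 1%:R (param_r R I).
  rewrite le_max; apply/orP; right; apply/(le_trans cK)/ler_log2.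
  by rewrite leq_max big_ord1 (tnth_nth 0%N) leqnn orbT.
have [t ht] := solM I.
have t0 : t = 0%N.
  have : ((t%:R : R)%:E <= (ratr 1 * bound 1 (param_r R I))%:E)%E.
    apply: le_trans (c'P _ _ cr); apply: ereal_sup_ubound.
    by exists t => //; exists I, (task_output I).
  by rewrite /bound /log2 ln1 mul0r !mulr0 lee_fin -[0](mulr0n 1) ler_nat leqn0 => /eqP.
(* After zero steps the output is still empty. *)
by move: ht; rewrite t0 => -[C [[<-] _]].
Qed.

End Bounds.

Theorem theorem8 (R : realType) :
  (~ exists M : machine,
       solves M /\ littleo_max (@worst_time R M) (@bound R)) /\
  (exists M : machine,
       solves M /\ littleo_min (@worst_time R M) (@bound R)).
Proof.
split; first by move=> [M [solM]]; exact: no_littleo_max.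
by exists selector; split; [exact: (selector_solves R) | exact: selector_littleo].
Qed.
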